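(* Suppose the EEC computation type $\underline R$ is different from $\underline\alpha$ for every simply-typed $\lambda$-calculus type constant $\alpha$. Then for every simple type $\sigma$, $\sigma^{ln}=(\sigma^n)^\circ$ (syntactic identity of types), hence $\sigma^{ln}\multimap\underline R=(\sigma^n)^\bullet$; and for every simply-typed term $\Theta\vdash M:\sigma$, $$\Theta^{ln}\multimap\underline R\mid-\vdash M^{ln}=(M^n)^\bullet:\sigma^{ln}\multimap\underline R$$ holds in EEC.
   Context: **EEC (enriched effect calculus).** There are value-type constants $\alpha,\beta,\ldots$ and a disjoint set of computation-type constants $\underline{\alpha},\underline{\beta},\ldots$. Value types $A,B,C$ and computation types $\underline{A},\underline{B},\underline{C},\underline{D}$ are generated by $A::=\alpha\mid 1\mid A\times B\mid A\to B\mid \underline{A}\mid \underline{A}\multimap\underline{B}$ and $\underline{A}::=\underline{\alpha}\mid\underline{1}\mid\underline{A}\,\&\,\underline{B}\mid A\Rightarrow\underline{B}\mid\underline{I}\mid\ !A\mid\ !A\otimes\underline{B}\mid\underline{0}\mid\underline{A}\oplus\underline{B}$ (every computation type is also a value type; $!A\otimes\underline{B}$ is one primitive binary constructor). Judgements are $\Gamma\mid -\vdash t:A$ and $\Gamma\mid z{:}\underline{A}\vdash t:\underline{B}$, where $\Gamma$ lists distinct variables with value types and the ''stoup'' holds at most one variable, of computation type; with nonempty stoup the result type is a computation type. Below $\Delta$ is empty or $z{:}\underline{D}$. Typing rules: $\Gamma,x{:}A\mid-\vdash x:A$; $\Gamma\mid-\vdash *:1$; pairs $\langle t,u\rangle:A\times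 B$, projections $\pi_1t,\pi_2t$; $\lambda x{:}A.t:A\to B$ from $\Gamma,x{:}A\mid-\vdash t:B$; application $t\,u$ (all with empty stoup). $\Gamma\mid z{:}\underline A\vdash z:\underline A$; $\Gamma\mid\Delta\vdash\underline{*}:\underline 1$; from $\Gamma\mid\Delta\vdash t:\underline A$, $\Gamma\mid\Delta\vdash u:\underline B$ get $\Gamma\mid\Delta\vdash\langle t,u\rangle_c:\underline A\,\&\,\underline B$, and from $\Gamma\mid\Delta\vdash t:\underline A\,\&\,\underline B$ get $\underline\pi_1t:\underline A$, $\underline\pi_2t:\underline B$; from $\Gamma,x{:}A\mid\Delta\vdash t:\underline B$ get $\Gamma\mid\Delta\vdash\underline\lambda x{:}A.t:A\Rightarrow\underline B$; from $\Gamma\mid\Delta\vdash s:A\Rightarrow\underline B$, $\Gamma\mid-\vdash t:A$ get $\Gamma\mid\Delta\vdash s@t:\underline B$; $\Gamma\mid-\vdash\top:\underline I$; from $\Gamma\mid\Delta\vdash t:\underline I$, $\Gamma\mid-\vdash u:\underline A$ get $\Gamma\mid\Delta\vdash \mathrm{let}\ \top\ \mathrm{be}\ t\ \mathrm{in}\ u:\underline A$; from $\Gamma\mid-\vdash t:A$ get $\Gamma\mid-\vdash\,!t:\,!A$; from $\Gamma\mid\Delta\vdash t:\,!A$, $\Gamma,x{:}A\mid-\vdash u:\underline B$ get $\Gamma\mid\Delta\vdash\mathrm{let}\ !x\ \mathrm{be}\ t\ \mathrm{in}\ u:\underline B$; from $\Gamma\mid-\vdash t:A$, $\Gamma\mid\Delta\vdash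 u:\underline B$ get $\Gamma\mid\Delta\vdash\,!t\otimes u:\,!A\otimes\underline B$; from $\Gamma\mid\Delta\vdash s:\,!A\otimes\underline B$, $\Gamma,x{:}A\mid y{:}\underline B\vdash t:\underline C$ get $\Gamma\mid\Delta\vdash\mathrm{let}\ !x\otimes y\ \mathrm{be}\ s\ \mathrm{in}\ t:\underline C$; from $\Gamma\mid\Delta\vdash t:\underline 0$ get $\Gamma\mid\Delta\vdash\mathrm{abort}_{\underline A}(t):\underline A$; $\mathrm{inl}\,t:\underline A\oplus\underline B$ from $t:\underline A$ and $\mathrm{inr}\,t$ from $t:\underline B$ (same $\Gamma\mid\Delta$); from $\Gamma\mid\Delta\vdash s:\underline A\oplus\underline B$, $\Gamma\mid x{:}\underline A\vdash t:\underline C$, $\Gamma\mid y{:}\underline B\vdash u:\underline C$ get $\Gamma\mid\Delta\vdash\mathrm{case}\ s\ \mathrm{of}\ (\mathrm{inl}\,x\Rightarrow t\mid\mathrm{inr}\,y\Rightarrow u):\underline C$; from $\Gamma\mid z{:}\underline A\vdash t:\underline B$ get $\Gamma\mid-\vdash\hat\lambda z{:}\underline A.t:\underline A\multimap\underline B$; from $\Gamma\mid-\vdash s:\underline A\multimap\underline B$, $\Gamma\mid\Delta\vdash t:\underline A$ get $\Gamma\mid\Delta\vdash s\{t\}:\underline B$. Equality $\Gamma\mid\Delta\vdash t=u:A$ is the least typed congruence (equivalence, compatible with all term formers, containing $\alpha$-equivalence) containing all well-typed instances of: $t=*$ for $t:1$; $\pi_1\langle t,u\rangle=t$, $\pi_2\langle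 t,u\rangle=u$, $\langle\pi_1t,\pi_2t\rangle=t$; $(\lambda x.t)u=t[u/x]$, $\lambda x.(t\,x)=t$ ($x$ not free in $t$); $t=\underline*$ for $t:\underline1$; $\underline\pi_1\langle t,u\rangle_c=t$, $\underline\pi_2\langle t,u\rangle_c=u$, $\langle\underline\pi_1t,\underline\pi_2t\rangle_c=t$; $(\underline\lambda x.t)@u=t[u/x]$, $\underline\lambda x.(t@x)=t$ ($x$ not free); $\mathrm{let}\ \top\ \mathrm{be}\ \top\ \mathrm{in}\ t=t$; $\mathrm{let}\ \top\ \mathrm{be}\ t\ \mathrm{in}\ u[\top/x]=u[t/x]$ for $\Gamma\mid x{:}\underline I\vdash u:\underline A$; $\mathrm{let}\ !x\ \mathrm{be}\ !t\ \mathrm{in}\ u=u[t/x]$; $\mathrm{let}\ !x\ \mathrm{be}\ t\ \mathrm{in}\ u[!x/y]=u[t/y]$ for $\Gamma\mid y{:}\,!A\vdash u:\underline B$; $\mathrm{let}\ !x\otimes y\ \mathrm{be}\ !t\otimes s\ \mathrm{in}\ u=u[t/x,s/y]$; $\mathrm{let}\ !x\otimes y\ \mathrm{be}\ t\ \mathrm{in}\ u[(!x\otimes y)/z]=u[t/z]$ for $\Gamma\mid z{:}\,!A\otimes\underline B\vdash u:\underline C$; $\mathrm{abort}_{\underline A}(t)=u[t/x]$ for $\Gamma\mid x{:}\underline 0\vdash u:\underline A$; $\mathrm{case}\ \mathrm{inl}\,t\ \mathrm{of}\ (\mathrm{inl}\,x\Rightarrow u\mid\mathrm{inr}\,y\Rightarrow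 u')=u[t/x]$ and symmetrically for $\mathrm{inr}$; $\mathrm{case}\ t\ \mathrm{of}\ (\mathrm{inl}\,x\Rightarrow u[\mathrm{inl}\,x/z]\mid\mathrm{inr}\,y\Rightarrow u[\mathrm{inr}\,y/z])=u[t/z]$ for $\Gamma\mid z{:}\underline A\oplus\underline B\vdash u:\underline C$; $(\hat\lambda x.t)\{u\}=t[u/x]$, $\hat\lambda x.(t\{x\})=t$ ($x$ not free). **Simply-typed $\lambda$-calculus.** Types $\sigma,\tau::=\alpha\mid 1\mid\sigma\times\tau\mid\sigma\to\tau$; terms $x,*,\langle M,N\rangle,\pi_1M,\pi_2M,\lambda x{:}\sigma.M,M\,N$ with standard typing in contexts $\Theta=x_1{:}\sigma_1,\ldots,x_n{:}\sigma_n$; each $\lambda$-type constant $\alpha$ has an associated EEC computation-type constant $\underline\alpha$. **Standard cbn translation into EEC.** $\alpha^n=\underline\alpha$, $1^n=\underline1$, $(\sigma\times\tau)^n=\sigma^n\&\tau^n$, $(\sigma\to\tau)^n=\sigma^n\Rightarrow\tau^n$; $\Theta\vdash M:\tau$ goes to $\Theta^n\mid-\vdash M^n:\tau^n$ (with $\Theta^n=x_1{:}\sigma_1^n,\ldots$) by $x^n=x$, $*^n=\underline*$, $\langle M,N\rangle^n=\langle M^n,N^n\rangle_c$, $(\pi_iM)^n=\underline\pi_iM^n$, $(\lambda x{:}\sigma.M)^n=\underline\lambda x{:}\sigma^n.M^n$, $(M\,N)^n=M^n@N^n$. **Linear-use cbn CPS translation** (relative to $\underline R$): $\alpha^{ln}=\underline\alpha$,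 $1^{ln}=\underline0$, $(\sigma\times\tau)^{ln}=\sigma^{ln}\oplus\tau^{ln}$, $(\sigma\to\tau)^{ln}=\,!(\sigma^{ln}\multimap\underline R)\otimes\tau^{ln}$; $\Theta^{ln}\multimap\underline R$ denotes $x_1{:}\sigma_1^{ln}\multimap\underline R,\ldots$; $\Theta\vdash M:\tau$ goes to $\Theta^{ln}\multimap\underline R\mid-\vdash M^{ln}:\tau^{ln}\multimap\underline R$ with $x^{ln}=x$; $*^{ln}=\hat\lambda k{:}\underline0.\,\mathrm{abort}_{\underline R}(k)$; $\langle M,N\rangle^{ln}=\hat\lambda k{:}\sigma^{ln}\oplus\tau^{ln}.\,\mathrm{case}\ k\ \mathrm{of}\ (\mathrm{inl}\,x\Rightarrow M^{ln}\{x\}\mid\mathrm{inr}\,y\Rightarrow N^{ln}\{y\})$; $(\pi_1M)^{ln}=\hat\lambda k{:}\sigma^{ln}.\,M^{ln}\{\mathrm{inl}\,k\}$; $(\pi_2M)^{ln}=\hat\lambda k{:}\tau^{ln}.\,M^{ln}\{\mathrm{inr}\,k\}$; $(\lambda x{:}\sigma.M)^{ln}=\hat\lambda k{:}\,!(\sigma^{ln}\multimap\underline R)\otimes\tau^{ln}.\,\mathrm{let}\ !x\otimes h\ \mathrm{be}\ k\ \mathrm{in}\ M^{ln}\{h\}$; $(M\,N)^{ln}=\hat\lambda k{:}\tau^{ln}.\,M^{ln}\{!(N^{ln})\otimes k\}$. **Generic self-translation relative to $\underline R$.** Types: $\alpha^\bullet=\alpha$, $1^\bullet=1$, $(A\times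 B)^\bullet=A^\bullet\times B^\bullet$, $(A\to B)^\bullet=A^\bullet\to B^\bullet$, $\underline A^\bullet=\underline A^\circ\multimap\underline R$, $(\underline A\multimap\underline B)^\bullet=\underline B^\circ\multimap\underline A^\circ$; $\underline\alpha^\circ=\underline\alpha$ if $\underline\alpha\neq\underline R$, $=\underline I$ if $\underline R$ is the constant $\underline\alpha$; $\underline1^\circ=\underline0$; $(\underline A\&\underline B)^\circ=\underline A^\circ\oplus\underline B^\circ$; $(A\Rightarrow\underline B)^\circ=\,!(A^\bullet)\otimes\underline B^\circ$; $\underline I^\circ=\underline R$; $(!A)^\circ=A^\bullet\Rightarrow\underline R$; $(!A\otimes\underline B)^\circ=A^\bullet\Rightarrow\underline B^\circ$; $\underline0^\circ=\underline1$; $(\underline A\oplus\underline B)^\circ=\underline A^\circ\&\underline B^\circ$; $\Gamma^\bullet$ applies $(\cdot)^\bullet$ to each type. Value terms $\Gamma\mid-\vdash t:A$ go to $\Gamma^\bullet\mid-\vdash t^\bullet:A^\bullet$ and stoup terms $\Gamma\mid z{:}\underline D\vdash t:\underline B$ to $\Gamma^\bullet\mid k_z{:}\underline B^\circ\vdash t^\circ:\underline D^\circ$ ($k_z$ a designated fresh variable for $z$; $k,h,k_x,k_y$ fresh). Value clauses: $x^\bullet=x$; $*^\bullet=*$; $\langle t,u\rangle^\bullet=\langle t^\bullet,u^\bullet\rangle$; $(\pi_it)^\bullet=\pi_it^\bullet$; $(\lambda x{:}A.t)^\bullet=\lambda x{:}A^\bullet.t^\bullet$; $(t\,u)^\bullet=t^\bullet\,u^\bullet$;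 $\underline*^\bullet=\hat\lambda k{:}\underline0.\,\mathrm{abort}_{\underline R}(k)$; $\langle t,u\rangle_c^\bullet=\hat\lambda k{:}\underline A^\circ\oplus\underline B^\circ.\,\mathrm{case}\ k\ \mathrm{of}\ (\mathrm{inl}\,k_x\Rightarrow t^\bullet\{k_x\}\mid\mathrm{inr}\,k_y\Rightarrow u^\bullet\{k_y\})$; $(\underline\pi_1t)^\bullet=\hat\lambda k{:}\underline A^\circ.\,t^\bullet\{\mathrm{inl}\,k\}$; $(\underline\pi_2t)^\bullet=\hat\lambda k{:}\underline B^\circ.\,t^\bullet\{\mathrm{inr}\,k\}$; $(\underline\lambda x{:}A.t)^\bullet=\hat\lambda k{:}\,!A^\bullet\otimes\underline B^\circ.\,\mathrm{let}\ !x\otimes h\ \mathrm{be}\ k\ \mathrm{in}\ t^\bullet\{h\}$; $(s@t)^\bullet=\hat\lambda k{:}\underline B^\circ.\,s^\bullet\{!(t^\bullet)\otimes k\}$; $\top^\bullet=\hat\lambda k{:}\underline R.\,k$; $(\mathrm{let}\ \top\ \mathrm{be}\ t\ \mathrm{in}\ u)^\bullet=\hat\lambda k{:}\underline A^\circ.\,t^\bullet\{u^\bullet\{k\}\}$; $(!t)^\bullet=\hat\lambda k{:}A^\bullet\Rightarrow\underline R.\,k@t^\bullet$; $(\mathrm{let}\ !x\ \mathrm{be}\ t\ \mathrm{in}\ u)^\bullet=\hat\lambda k{:}\underline B^\circ.\,t^\bullet\{\underline\lambda x{:}A^\bullet.\,u^\bullet\{k\}\}$; $(!t\otimes u)^\bullet=\hat\lambda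 k{:}A^\bullet\Rightarrow\underline B^\circ.\,u^\bullet\{k@t^\bullet\}$; $(\mathrm{let}\ !x\otimes y\ \mathrm{be}\ s\ \mathrm{in}\ t)^\bullet=\hat\lambda k{:}\underline C^\circ.\,s^\bullet\{\underline\lambda x{:}A^\bullet.\,t^\circ[k/k_y]\}$; $(\mathrm{abort}_{\underline A}(t))^\bullet=\hat\lambda k{:}\underline A^\circ.\,t^\bullet\{\underline*\}$; $(\mathrm{inl}\,t)^\bullet=\hat\lambda k{:}\underline A^\circ\&\underline B^\circ.\,t^\bullet\{\underline\pi_1k\}$; $(\mathrm{inr}\,t)^\bullet=\hat\lambda k{:}\underline A^\circ\&\underline B^\circ.\,t^\bullet\{\underline\pi_2k\}$; $(\mathrm{case}\ s\ \mathrm{of}\ (\mathrm{inl}\,x\Rightarrow t\mid\mathrm{inr}\,y\Rightarrow u))^\bullet=\hat\lambda k{:}\underline C^\circ.\,s^\bullet\{\langle t^\circ[k/k_x],u^\circ[k/k_y]\rangle_c\}$; $(\hat\lambda z{:}\underline A.t)^\bullet=\hat\lambda k{:}\underline B^\circ.\,t^\circ[k/k_z]$; $(s\{t\})^\bullet=\hat\lambda k{:}\underline B^\circ.\,t^\bullet\{s^\bullet\{k\}\}$. Stoup clauses: $z^\circ=k_z$; $\underline*^\circ=\mathrm{abort}_{\underline D^\circ}(k_z)$; $\langle t,u\rangle_c^\circ=\mathrm{case}\ k_z\ \mathrm{of}\ (\mathrm{inl}\,k_x\Rightarrow t^\circ[k_x/k_z]\mid\mathrm{inr}\,k_y\Rightarrow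 u^\circ[k_y/k_z])$; $(\underline\pi_1t)^\circ=t^\circ[\mathrm{inl}\,k_z/k_z]$; $(\underline\pi_2t)^\circ=t^\circ[\mathrm{inr}\,k_z/k_z]$; $(\underline\lambda x{:}A.t)^\circ=\mathrm{let}\ !x\otimes h\ \mathrm{be}\ k_z\ \mathrm{in}\ t^\circ[h/k_z]$; $(s@t)^\circ=s^\circ[(!(t^\bullet)\otimes k_z)/k_z]$; $(\mathrm{let}\ \top\ \mathrm{be}\ t\ \mathrm{in}\ u)^\circ=t^\circ[u^\bullet\{k_z\}/k_z]$; $(\mathrm{let}\ !x\ \mathrm{be}\ t\ \mathrm{in}\ u)^\circ=t^\circ[(\underline\lambda x{:}A^\bullet.\,u^\bullet\{k_z\})/k_z]$; $(!t\otimes u)^\circ=u^\circ[(k_z@t^\bullet)/k_z]$; $(\mathrm{let}\ !x\otimes y\ \mathrm{be}\ s\ \mathrm{in}\ t)^\circ=s^\circ[(\underline\lambda x{:}A^\bullet.\,t^\circ[k_z/k_y])/k_z]$; $(\mathrm{abort}(t))^\circ=t^\circ[\underline*/k_z]$; $(\mathrm{inl}\,t)^\circ=t^\circ[\underline\pi_1k_z/k_z]$; $(\mathrm{inr}\,t)^\circ=t^\circ[\underline\pi_2k_z/k_z]$; $(\mathrm{case}\ s\ \mathrm{of}\ (\mathrm{inl}\,x\Rightarrow t\mid\mathrm{inr}\,y\Rightarrow u))^\circ=s^\circ[\langle t^\circ[k_z/k_x],u^\circ[k_z/k_y]\rangle_c/k_z]$; $(s\{t\})^\circ=t^\circ[s^\bullet\{k_z\}/k_z]$.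 *)

(* Defs.v *)
From mathcomp Require Import all_boot.

Set Implicit Arguments.
Unset Strict Implicit.
Unset Printing Implicit Defensive.

(* Typed de Bruijn indices, shared by EEC and the lambda-calculus: [var s a] is
   the type of positions of [a] in the context [s], most recent variable first. *)
Inductive var {T : Type} : seq T -> T -> Type :=
| var0 {s a} : var (a :: s) a
| varS {s a b} : var s a -> var (b :: s) a.

Fixpoint var_map {T U : Type} (f : T -> U) {s : seq T} {a : T} (x : var s a) :
    var (map f s) (f a) :=
  match x in var s a return var (map f s) (f a) with
  | var0 _ _ => var0
  | varS _ _ _ y => varS (var_map f y)
  end.

Definition var_case {T : Type} {P : T -> Type} {s : seq T} {b : T}
    (p0 : P b) (pS : forall a, var s a -> P a) {a : T} (x : var (b :: s) a) : P a :=
  match x in var s' a' return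
    (if s' is b' :: s0 then P b' -> (forall a, var s0 a -> P a) -> P a' else unit)
  with
  | var0 _ _ => fun p0 _ => p0
  | varS _ _ _ y => fun _ pS => pS _ y
  end p0 pS.

Section EEC.

Variables VC CC : Type.

Inductive vtype : Type :=
| VConst (a : VC)
| VOne
| VProd (A B : vtype)
| VArr (A B : vtype)
| VComp (A : ctype)
| VLolli (A B : ctype)
with ctype : Type :=
| CConst (a : CC)
| COne
| CWith (A B : ctype)
| CPow (A : vtype) (B : ctype)      (* A => B *)
| CI
| CBang (A : vtype)
| CTens (A : vtype) (B : ctype)     (* !A (x) B, a single binary constructor *)
| CZero
| CPlus (A B : ctype).

#[local] Coercion VComp : ctype >-> vtype.

Definition vctx := seq vtype.
Definition stoup := option ctype.

(* [tm G D A] is the type of terms G | D |- t : A, presented as typing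
   derivations.  The stoup holds at most one variable, so that variable is
   nameless: [t_hole] refers to it, and every binder of a stoup variable
   ([t_llam], [t_lettens], [t_case]) opens a fresh stoup.  Each rule that allows
   a nonempty stoup produces a computation type. *)
Inductive tm : vctx -> stoup -> vtype -> Type :=
| t_var {G A} : var G A -> tm G None A
| t_unit {G} : tm G None VOne
| t_pair {G A B} : tm G None A -> tm G None B -> tm G None (VProd A B)
| t_fst {G A B} : tm G None (VProd A B) -> tm G None A
| t_snd {G A B} : tm G None (VProd A B) -> tm G None B
| t_lam {G A B} : tm (A :: G) None B -> tm G None (VArr A B)
| t_app {G A B} : tm G None (VArr A B) -> tm G None A -> tm G None B
| t_hole {G} {A : ctype} : tm G (Some A) A
| t_cunit {G D} : tm G D COne
| t_cpair {G D} {A B : ctype} : tm G D A -> tm G D B -> tm G D (CWith A B)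
| t_cfst {G D} {A B : ctype} : tm G D (CWith A B) -> tm G D A
| t_csnd {G D} {A B : ctype} : tm G D (CWith A B) -> tm G D B
| t_clam {G D A} {B : ctype} : tm (A :: G) D B -> tm G D (CPow A B)
| t_capp {G D A} {B : ctype} : tm G D (CPow A B) -> tm G None A -> tm G D B
| t_top {G} : tm G None CI
| t_lettop {G D} {A : ctype} : tm G D CI -> tm G None A -> tm G D A
| t_bang {G A} : tm G None A -> tm G None (CBang A)
| t_letbang {G D A} {B : ctype} : tm G D (CBang A) -> tm (A :: G) None B -> tm G D B
| t_tens {G D A} {B : ctype} : tm G None A -> tm G D B -> tm G D (CTens A B)
| t_lettens {G D A} {B C : ctype} :
    tm G D (CTens A B) -> tm (A :: G) (Some B) C -> tm G D C
| t_abort {G D} (A : ctype) : tm G D CZero -> tm G D A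
| t_inl {G D} {A B : ctype} : tm G D A -> tm G D (CPlus A B)
| t_inr {G D} {A B : ctype} : tm G D B -> tm G D (CPlus A B)
| t_case {G D} {A B C : ctype} :
    tm G D (CPlus A B) -> tm G (Some A) C -> tm G (Some B) C -> tm G D C
| t_llam {G} {A B : ctype} : tm G (Some A) B -> tm G None (VLolli A B)
| t_lapp {G D} {A B : ctype} : tm G None (VLolli A B) -> tm G D A -> tm G D B.

Definition ren (G G' : vctx) := forall A, var G A -> var G' A.

Definition ren_up {G G'} (B : vtype) (r : ren G G') : ren (B :: G) (B :: G') :=
  @var_case _ (var (B :: G')) G B var0 (fun A x => varS (r A x)).
Arguments ren_up {G G'} B r.

Fixpoint rename {G D A} (t : tm G D A) : forall G', ren G G' -> tm G' D A :=
  match t in tm G D A return forall G', ren G G' -> tm G' D A with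
  | t_var _ _ x => fun _ r => t_var (r _ x)
  | t_unit _ => fun _ _ => t_unit
  | t_pair _ _ _ t u => fun _ r => t_pair (rename t r) (rename u r)
  | t_fst _ _ _ t => fun _ r => t_fst (rename t r)
  | t_snd _ _ _ t => fun _ r => t_snd (rename t r)
  | t_lam _ A _ t => fun _ r => t_lam (rename t (ren_up A r))
  | t_app _ _ _ t u => fun _ r => t_app (rename t r) (rename u r)
  | t_hole _ _ => fun _ _ => t_hole
  | t_cunit _ _ => fun _ _ => t_cunit
  | t_cpair _ _ _ _ t u => fun _ r => t_cpair (rename t r) (rename u r)
  | t_cfst _ _ _ _ t => fun _ r => t_cfst (rename t r)
  | t_csnd _ _ _ _ t => fun _ r => t_csnd (rename t r)
  | t_clam _ _ A _ t => fun _ r => t_clam (rename t (ren_up A r))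
  | t_capp _ _ _ _ t u => fun _ r => t_capp (rename t r) (rename u r)
  | t_top _ => fun _ _ => t_top
  | t_lettop _ _ _ t u => fun _ r => t_lettop (rename t r) (rename u r)
  | t_bang _ _ t => fun _ r => t_bang (rename t r)
  | t_letbang _ _ A _ t u => fun _ r => t_letbang (rename t r) (rename u (ren_up A r))
  | t_tens _ _ _ _ t u => fun _ r => t_tens (rename t r) (rename u r)
  | t_lettens _ _ A _ _ s t => fun _ r => t_lettens (rename s r) (rename t (ren_up A r))
  | t_abort _ _ A t => fun _ r => t_abort A (rename t r)
  | t_inl _ _ _ _ t => fun _ r => t_inl (rename t r)
  | t_inr _ _ _ _ t => fun _ r => t_inr (rename t r)
  | t_case _ _ _ _ _ s t u => fun _ r => t_case (rename s r) (rename t r) (rename u r)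
  | t_llam _ _ _ t => fun _ r => t_llam (rename t r)
  | t_lapp _ _ _ _ s t => fun _ r => t_lapp (rename s r) (rename t r)
  end.

Definition wk {G D A} (B : vtype) (t : tm G D A) : tm (B :: G) D A :=
  rename t (fun _ x => varS x).

Definition sub (G G' : vctx) := forall A, var G A -> tm G' None A.

Definition sub_up {G G'} (B : vtype) (s : sub G G') : sub (B :: G) (B :: G') :=
  @var_case _ (tm (B :: G') None) G B (t_var var0) (fun A x => wk B (s A x)).
Arguments sub_up {G G'} B s.

(* Substitution for the value variables; the stoup is untouched. *)
Fixpoint vsubst {G D A} (t : tm G D A) : forall G', sub G G' -> tm G' D A :=
  match t in tm G D A return forall G', sub G G' -> tm G' D A with
  | t_var _ _ x => fun _ r => r _ x
  | t_unit _ => fun _ _ => t_unit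
  | t_pair _ _ _ t u => fun _ r => t_pair (vsubst t r) (vsubst u r)
  | t_fst _ _ _ t => fun _ r => t_fst (vsubst t r)
  | t_snd _ _ _ t => fun _ r => t_snd (vsubst t r)
  | t_lam _ A _ t => fun _ r => t_lam (vsubst t (sub_up A r))
  | t_app _ _ _ t u => fun _ r => t_app (vsubst t r) (vsubst u r)
  | t_hole _ _ => fun _ _ => t_hole
  | t_cunit _ _ => fun _ _ => t_cunit
  | t_cpair _ _ _ _ t u => fun _ r => t_cpair (vsubst t r) (vsubst u r)
  | t_cfst _ _ _ _ t => fun _ r => t_cfst (vsubst t r)
  | t_csnd _ _ _ _ t => fun _ r => t_csnd (vsubst t r)
  | t_clam _ _ A _ t => fun _ r => t_clam (vsubst t (sub_up A r))
  | t_capp _ _ _ _ t u => fun _ r => t_capp (vsubst t r) (vsubst u r)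
  | t_top _ => fun _ _ => t_top
  | t_lettop _ _ _ t u => fun _ r => t_lettop (vsubst t r) (vsubst u r)
  | t_bang _ _ t => fun _ r => t_bang (vsubst t r)
  | t_letbang _ _ A _ t u => fun _ r => t_letbang (vsubst t r) (vsubst u (sub_up A r))
  | t_tens _ _ _ _ t u => fun _ r => t_tens (vsubst t r) (vsubst u r)
  | t_lettens _ _ A _ _ s t => fun _ r => t_lettens (vsubst s r) (vsubst t (sub_up A r))
  | t_abort _ _ A t => fun _ r => t_abort A (vsubst t r)
  | t_inl _ _ _ _ t => fun _ r => t_inl (vsubst t r)
  | t_inr _ _ _ _ t => fun _ r => t_inr (vsubst t r)
  | t_case _ _ _ _ _ s t u => fun _ r => t_case (vsubst s r) (vsubst t r) (vsubst u r)
  | t_llam _ _ _ t => fun _ r => t_llam (vsubst t r)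
  | t_lapp _ _ _ _ s t => fun _ r => t_lapp (vsubst s r) (vsubst t r)
  end.

(* t[u/x] for the most recent value variable x *)
Definition vsubst1 {G D A B} (t : tm (A :: G) D B) (u : tm G None A) : tm G D B :=
  vsubst t (@var_case _ (tm G None) G A u (fun C x => t_var x)).

(* [ssubst t u] is t[u/z] for the stoup variable z of t, where u has an arbitrary
   stoup.  [ssubst_ty] makes the definition by recursion on t typecheck: the
   function is trivial on terms with empty stoup. *)
Definition ssubst_ty (G : vctx) (D : stoup) (A : vtype) : Type :=
  if D is Some E then forall D' : stoup, tm G D' E -> tm G D' A else unit.

Fixpoint ssubst_rec {G D A} (t : tm G D A) : ssubst_ty G D A :=
  match t in tm G D A return ssubst_ty G D A with
  | t_var _ _ _ => tt
  | t_unit _ => tt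
  | t_pair _ _ _ _ _ => tt
  | t_fst _ _ _ _ => tt
  | t_snd _ _ _ _ => tt
  | t_lam _ _ _ _ => tt
  | t_app _ _ _ _ _ => tt
  | t_hole _ _ => fun _ u => u
  | t_cunit _ D =>
      match D return ssubst_ty _ D _ with
      | Some _ => fun _ _ => t_cunit
      | None => tt
      end
  | t_cpair _ D _ _ t1 t2 =>
      match D return ssubst_ty _ D _ -> ssubst_ty _ D _ -> ssubst_ty _ D _ with
      | Some _ => fun s1 s2 _ u => t_cpair (s1 _ u) (s2 _ u)
      | None => fun _ _ => tt
      end (ssubst_rec t1) (ssubst_rec t2)
  | t_cfst _ D _ _ t1 =>
      match D return ssubst_ty _ D _ -> ssubst_ty _ D _ with
      | Some _ => fun s1 _ u => t_cfst (s1 _ u)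
      | None => fun _ => tt
      end (ssubst_rec t1)
  | t_csnd _ D _ _ t1 =>
      match D return ssubst_ty _ D _ -> ssubst_ty _ D _ with
      | Some _ => fun s1 _ u => t_csnd (s1 _ u)
      | None => fun _ => tt
      end (ssubst_rec t1)
  | t_clam _ D A _ t1 =>
      match D return ssubst_ty _ D _ -> ssubst_ty _ D _ with
      | Some _ => fun s1 _ u => t_clam (s1 _ (wk A u))
      | None => fun _ => tt
      end (ssubst_rec t1)
  | t_capp _ D _ _ t1 t2 =>
      match D return ssubst_ty _ D _ -> ssubst_ty _ D _ with
      | Some _ => fun s1 _ u => t_capp (s1 _ u) t2
      | None => fun _ => tt
      end (ssubst_rec t1)
  | t_top _ => tt
  | t_lettop _ D _ t1 t2 =>
      match D return ssubst_ty _ D _ -> ssubst_ty _ D _ with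
      | Some _ => fun s1 _ u => t_lettop (s1 _ u) t2
      | None => fun _ => tt
      end (ssubst_rec t1)
  | t_bang _ _ _ => tt
  | t_letbang _ D _ _ t1 t2 =>
      match D return ssubst_ty _ D _ -> ssubst_ty _ D _ with
      | Some _ => fun s1 _ u => t_letbang (s1 _ u) t2
      | None => fun _ => tt
      end (ssubst_rec t1)
  | t_tens _ D _ _ t1 t2 =>
      match D return ssubst_ty _ D _ -> ssubst_ty _ D _ with
      | Some _ => fun s2 _ u => t_tens t1 (s2 _ u)
      | None => fun _ => tt
      end (ssubst_rec t2)
  | t_lettens _ D _ _ _ t1 t2 =>
      match D return ssubst_ty _ D _ -> ssubst_ty _ D _ with
      | Some _ => fun s1 _ u => t_lettens (s1 _ u) t2
      | None => fun _ => tt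
      end (ssubst_rec t1)
  | t_abort _ D A t1 =>
      match D return ssubst_ty _ D _ -> ssubst_ty _ D _ with
      | Some _ => fun s1 _ u => t_abort A (s1 _ u)
      | None => fun _ => tt
      end (ssubst_rec t1)
  | t_inl _ D _ _ t1 =>
      match D return ssubst_ty _ D _ -> ssubst_ty _ D _ with
      | Some _ => fun s1 _ u => t_inl (s1 _ u)
      | None => fun _ => tt
      end (ssubst_rec t1)
  | t_inr _ D _ _ t1 =>
      match D return ssubst_ty _ D _ -> ssubst_ty _ D _ with
      | Some _ => fun s1 _ u => t_inr (s1 _ u)
      | None => fun _ => tt
      end (ssubst_rec t1)
  | t_case _ D _ _ _ t1 t2 t3 =>
      match D return ssubst_ty _ D _ -> ssubst_ty _ D _ with
      | Some _ => fun s1 _ u => t_case (s1 _ u) t2 t3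
      | None => fun _ => tt
      end (ssubst_rec t1)
  | t_llam _ _ _ _ => tt
  | t_lapp _ D _ _ t1 t2 =>
      match D return ssubst_ty _ D _ -> ssubst_ty _ D _ with
      | Some _ => fun s2 _ u => t_lapp t1 (s2 _ u)
      | None => fun _ => tt
      end (ssubst_rec t2)
  end.

Definition ssubst {G D} {E : ctype} {A} (t : tm G (Some E) A) (u : tm G D E) :
    tm G D A :=
  ssubst_rec t D u.

Inductive eqtm : forall {G D A}, tm G D A -> tm G D A -> Prop :=
| eqt_refl {G D A} (t : tm G D A) : eqtm t t
| eqt_sym {G D A} (t u : tm G D A) : eqtm t u -> eqtm u t
| eqt_trans {G D A} (t u v : tm G D A) : eqtm t u -> eqtm u v -> eqtm t v
| eqt_pair {G A B} (t t' : tm G None A) (u u' : tm G None B) :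
    eqtm t t' -> eqtm u u' -> eqtm (t_pair t u) (t_pair t' u')
| eqt_fst {G A B} (t t' : tm G None (VProd A B)) :
    eqtm t t' -> eqtm (t_fst t) (t_fst t')
| eqt_snd {G A B} (t t' : tm G None (VProd A B)) :
    eqtm t t' -> eqtm (t_snd t) (t_snd t')
| eqt_lam {G A B} (t t' : tm (A :: G) None B) :
    eqtm t t' -> eqtm (t_lam t) (t_lam t')
| eqt_app {G A B} (t t' : tm G None (VArr A B)) (u u' : tm G None A) :
    eqtm t t' -> eqtm u u' -> eqtm (t_app t u) (t_app t' u')
| eqt_cpair {G D} {A B : ctype} (t t' : tm G D A) (u u' : tm G D B) :
    eqtm t t' -> eqtm u u' -> eqtm (t_cpair t u) (t_cpair t' u')
| eqt_cfst {G D} {A B : ctype} (t t' : tm G D (CWith A B)) :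
    eqtm t t' -> eqtm (t_cfst t) (t_cfst t')
| eqt_csnd {G D} {A B : ctype} (t t' : tm G D (CWith A B)) :
    eqtm t t' -> eqtm (t_csnd t) (t_csnd t')
| eqt_clam {G D A} {B : ctype} (t t' : tm (A :: G) D B) :
    eqtm t t' -> eqtm (t_clam t) (t_clam t')
| eqt_capp {G D A} {B : ctype} (t t' : tm G D (CPow A B)) (u u' : tm G None A) :
    eqtm t t' -> eqtm u u' -> eqtm (t_capp t u) (t_capp t' u')
| eqt_lettop {G D} {A : ctype} (t t' : tm G D CI) (u u' : tm G None A) :
    eqtm t t' -> eqtm u u' -> eqtm (t_lettop t u) (t_lettop t' u')
| eqt_bang {G A} (t t' : tm G None A) :
    eqtm t t' -> eqtm (t_bang t) (t_bang t')
| eqt_letbang {G D A} {B : ctype} (t t' : tm G D (CBang A)) (u u' : tm (A :: G) None B) :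
    eqtm t t' -> eqtm u u' -> eqtm (t_letbang t u) (t_letbang t' u')
| eqt_tens {G D A} {B : ctype} (t t' : tm G None A) (u u' : tm G D B) :
    eqtm t t' -> eqtm u u' -> eqtm (t_tens t u) (t_tens t' u')
| eqt_lettens {G D A} {B C : ctype} (s s' : tm G D (CTens A B))
    (t t' : tm (A :: G) (Some B) C) :
    eqtm s s' -> eqtm t t' -> eqtm (t_lettens s t) (t_lettens s' t')
| eqt_abort {G D} {A : ctype} (t t' : tm G D CZero) :
    eqtm t t' -> eqtm (t_abort A t) (t_abort A t')
| eqt_inl {G D} {A B : ctype} (t t' : tm G D A) :
    eqtm t t' -> eqtm (@t_inl G D A B t) (t_inl t')
| eqt_inr {G D} {A B : ctype} (t t' : tm G D B) :
    eqtm t t' -> eqtm (@t_inr G D A B t) (t_inr t')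
| eqt_case {G D} {A B C : ctype} (s s' : tm G D (CPlus A B))
    (t t' : tm G (Some A) C) (u u' : tm G (Some B) C) :
    eqtm s s' -> eqtm t t' -> eqtm u u' -> eqtm (t_case s t u) (t_case s' t' u')
| eqt_llam {G} {A B : ctype} (t t' : tm G (Some A) B) :
    eqtm t t' -> eqtm (t_llam t) (t_llam t')
| eqt_lapp {G D} {A B : ctype} (s s' : tm G None (VLolli A B)) (t t' : tm G D A) :
    eqtm s s' -> eqtm t t' -> eqtm (t_lapp s t) (t_lapp s' t')
| eqt_unit_eta {G} (t : tm G None VOne) : eqtm t t_unit
| eqt_fst_beta {G A B} (t : tm G None A) (u : tm G None B) :
    eqtm (t_fst (t_pair t u)) t
| eqt_snd_beta {G A B} (t : tm G None A) (u : tm G None B) :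
    eqtm (t_snd (t_pair t u)) u
| eqt_pair_eta {G A B} (t : tm G None (VProd A B)) :
    eqtm (t_pair (t_fst t) (t_snd t)) t
| eqt_lam_beta {G A B} (t : tm (A :: G) None B) (u : tm G None A) :
    eqtm (t_app (t_lam t) u) (vsubst1 t u)
| eqt_lam_eta {G A B} (t : tm G None (VArr A B)) :
    eqtm (t_lam (t_app (wk A t) (t_var var0))) t
| eqt_cunit_eta {G D} (t : tm G D COne) : eqtm t t_cunit
| eqt_cfst_beta {G D} {A B : ctype} (t : tm G D A) (u : tm G D B) :
    eqtm (t_cfst (t_cpair t u)) t
| eqt_csnd_beta {G D} {A B : ctype} (t : tm G D A) (u : tm G D B) :
    eqtm (t_csnd (t_cpair t u)) u
| eqt_cpair_eta {G D} {A B : ctype} (t : tm G D (CWith A B)) :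
    eqtm (t_cpair (t_cfst t) (t_csnd t)) t
| eqt_clam_beta {G D A} {B : ctype} (t : tm (A :: G) D B) (u : tm G None A) :
    eqtm (t_capp (t_clam t) u) (vsubst1 t u)
| eqt_clam_eta {G D A} {B : ctype} (t : tm G D (CPow A B)) :
    eqtm (t_clam (t_capp (wk A t) (t_var var0))) t
| eqt_top_beta {G} {A : ctype} (t : tm G None A) :
    eqtm (t_lettop t_top t) t
| eqt_top_eta {G D} {A : ctype} (t : tm G D CI) (u : tm G (Some CI) A) :
    eqtm (t_lettop t (ssubst u t_top)) (ssubst u t)
| eqt_bang_beta {G A} {B : ctype} (t : tm G None A) (u : tm (A :: G) None B) :
    eqtm (t_letbang (t_bang t) u) (vsubst1 u t)
| eqt_bang_eta {G D A} {B : ctype} (t : tm G D (CBang A)) (u : tm G (Some (CBang A)) B) :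
    eqtm (t_letbang t (ssubst (wk A u) (t_bang (t_var var0)))) (ssubst u t)
| eqt_tens_beta {G D A} {B C : ctype} (t : tm G None A) (s : tm G D B)
    (u : tm (A :: G) (Some B) C) :
    eqtm (t_lettens (t_tens t s) u) (ssubst (vsubst1 u t) s)
| eqt_tens_eta {G D A} {B C : ctype} (t : tm G D (CTens A B))
    (u : tm G (Some (CTens A B)) C) :
    eqtm (t_lettens t (ssubst (wk A u) (t_tens (t_var var0) t_hole))) (ssubst u t)
| eqt_zero_eta {G D} {A : ctype} (t : tm G D CZero) (u : tm G (Some CZero) A) :
    eqtm (t_abort A t) (ssubst u t)
| eqt_inl_beta {G D} {A B C : ctype} (t : tm G D A)
    (u : tm G (Some A) C) (u' : tm G (Some B) C) :
    eqtm (t_case (t_inl t) u u') (ssubst u t)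
| eqt_inr_beta {G D} {A B C : ctype} (t : tm G D B)
    (u : tm G (Some A) C) (u' : tm G (Some B) C) :
    eqtm (t_case (t_inr t) u u') (ssubst u' t)
| eqt_plus_eta {G D} {A B C : ctype} (t : tm G D (CPlus A B))
    (u : tm G (Some (CPlus A B)) C) :
    eqtm (t_case t (ssubst u (t_inl t_hole)) (ssubst u (t_inr t_hole))) (ssubst u t)
| eqt_llam_beta {G D} {A B : ctype} (t : tm G (Some A) B) (u : tm G D A) :
    eqtm (t_lapp (t_llam t) u) (ssubst t u)
| eqt_llam_eta {G} {A B : ctype} (t : tm G None (VLolli A B)) :
    eqtm (t_llam (t_lapp t t_hole)) t.

(* Syntactically identical contexts and types need not be convertible, hence this
   transport. *)
Definition tm_cast {G G' D A A'} (eG : G = G') (eA : A = A') (t : tm G D A) :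
    tm G' D A' :=
  match eG in _ = H, eA in _ = B return tm H D B with
  | erefl, erefl => t
  end.

End EEC.

Arguments VOne {VC CC}.
Arguments COne {VC CC}.
Arguments CI {VC CC}.
Arguments CZero {VC CC}.
Arguments VConst {VC CC} a.
Arguments CConst {VC CC} a.
Arguments t_unit {VC CC G}.
Arguments t_hole {VC CC G A}.
Arguments t_cunit {VC CC G D}.
Arguments t_top {VC CC G}.
#[local] Coercion VComp : ctype >-> vtype.

Section SelfTranslation.

Variables (VC : Type) (CC : eqType) (R : ctype VC CC).

Fixpoint vbullet (A : vtype VC CC) : vtype VC CC :=
  match A with
  | VConst a => VConst a
  | VOne => VOne
  | VProd A B => VProd (vbullet A) (vbullet B)
  | VArr A B => VArr (vbullet A) (vbullet B)
  | VComp A => VLolli (ccirc A) R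
  | VLolli A B => VLolli (ccirc B) (ccirc A)
  end
with ccirc (A : ctype VC CC) : ctype VC CC :=
  match A with
  | CConst a => if R is CConst b then (if a == b then CI else CConst a) else CConst a
  | COne => CZero
  | CWith A B => CPlus (ccirc A) (ccirc B)
  | CPow A B => CTens (vbullet A) (ccirc B)
  | CI => R
  | CBang A => CPow (vbullet A) R
  | CTens A B => CPow (vbullet A) (ccirc B)
  | CZero => COne
  | CPlus A B => CWith (ccirc A) (ccirc B)
  end.

(* A value term G | - |- t : A goes to G^bullet | - |- t^bullet : A^bullet, a
   stoup term G | z:D |- t : B to G^bullet | k:B^circ |- t^circ : D^circ; no term
   has a nonempty stoup and a type that is not a computation type. *)
Definition self_ty (G : vctx VC CC) (D : stoup VC CC) (A : vtype VC CC) : Type :=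
  match D, A with
  | None, A => tm (map vbullet G) None (vbullet A)
  | Some E, VComp B => tm (map vbullet G) (Some (ccirc B)) (ccirc E)
  | Some _, _ => Empty_set
  end.

(* The branch [None] is the clause for t^bullet and the branch [Some E] the clause
   for t^circ.  Renamings such as [k/k_z] of the nameless stoup variable are the
   identity. *)
Fixpoint self_tr {G D A} (t : tm G D A) : self_ty G D A :=
  match t in tm G D A return self_ty G D A with
  | t_var _ _ x => t_var (var_map vbullet x)
  | t_unit _ => t_unit
  | t_pair _ _ _ t u => t_pair (self_tr t) (self_tr u)
  | t_fst _ _ _ t => t_fst (self_tr t)
  | t_snd _ _ _ t => t_snd (self_tr t)
  | t_lam _ _ _ t => t_lam (self_tr t)
  | t_app _ _ _ t u => t_app (self_tr t) (self_tr u)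
  | t_hole _ _ => t_hole
  | t_cunit G D =>
      match D return self_ty G D COne with
      | None => t_llam (t_abort R t_hole)
      | Some E => t_abort (ccirc E) t_hole
      end
  | t_cpair G D A B t u =>
      match D return self_ty G D A -> self_ty G D B -> self_ty G D (CWith A B) with
      | None => fun t' u' => t_llam (t_case t_hole (t_lapp t' t_hole) (t_lapp u' t_hole))
      | Some E => fun t' u' => t_case t_hole t' u'
      end (self_tr t) (self_tr u)
  | t_cfst G D A B t =>
      match D return self_ty G D (CWith A B) -> self_ty G D A with
      | None => fun t' => t_llam (t_lapp t' (t_inl t_hole))
      | Some E => fun t' => ssubst t' (t_inl t_hole)
      end (self_tr t)
  | t_csnd G D A B t =>
      match D return self_ty G D (CWith A B) -> self_ty G D B with
      | None => fun t' => t_llam (t_lapp t' (t_inr t_hole))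
      | Some E => fun t' => ssubst t' (t_inr t_hole)
      end (self_tr t)
  | t_clam G D A B t =>
      match D return self_ty (A :: G) D B -> self_ty G D (CPow A B) with
      | None => fun t' => t_llam (t_lettens t_hole (t_lapp t' t_hole))
      | Some E => fun t' => t_lettens t_hole t'
      end (self_tr t)
  | t_capp G D A B s t =>
      match D return self_ty G D (CPow A B) -> self_ty G None A -> self_ty G D B with
      | None => fun s' t' => t_llam (t_lapp s' (t_tens t' t_hole))
      | Some E => fun s' t' => ssubst s' (t_tens t' t_hole)
      end (self_tr s) (self_tr t)
  | t_top _ => t_llam t_hole
  | t_lettop G D A t u =>
      match D return self_ty G D CI -> self_ty G None A -> self_ty G D A with
      | None => fun t' u' => t_llam (t_lapp t' (t_lapp u' t_hole))
      | Some E => fun t' u' => ssubst t' (t_lapp u' t_hole)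
      end (self_tr t) (self_tr u)
  | t_bang _ _ t => t_llam (t_capp t_hole (self_tr t))
  | t_letbang G D A B t u =>
      match D return self_ty G D (CBang A) -> self_ty (A :: G) None B -> self_ty G D B with
      | None => fun t' u' => t_llam (t_lapp t' (t_clam (t_lapp u' t_hole)))
      | Some E => fun t' u' => ssubst t' (t_clam (t_lapp u' t_hole))
      end (self_tr t) (self_tr u)
  | t_tens G D A B t u =>
      match D return self_ty G None A -> self_ty G D B -> self_ty G D (CTens A B) with
      | None => fun t' u' => t_llam (t_lapp u' (t_capp t_hole t'))
      | Some E => fun t' u' => ssubst u' (t_capp t_hole t')
      end (self_tr t) (self_tr u)
  | t_lettens G D A B C s t =>
      match D return
        self_ty G D (CTens A B) -> self_ty (A :: G) (Some B) C -> self_ty G D C with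
      | None => fun s' t' => t_llam (t_lapp s' (t_clam t'))
      | Some E => fun s' t' => ssubst s' (t_clam t')
      end (self_tr s) (self_tr t)
  | t_abort G D A t =>
      match D return self_ty G D CZero -> self_ty G D A with
      | None => fun t' => t_llam (t_lapp t' t_cunit)
      | Some E => fun t' => ssubst t' t_cunit
      end (self_tr t)
  | t_inl G D A B t =>
      match D return self_ty G D A -> self_ty G D (CPlus A B) with
      | None => fun t' => t_llam (t_lapp t' (t_cfst t_hole))
      | Some E => fun t' => ssubst t' (t_cfst t_hole)
      end (self_tr t)
  | t_inr G D A B t =>
      match D return self_ty G D B -> self_ty G D (CPlus A B) with
      | None => fun t' => t_llam (t_lapp t' (t_csnd t_hole))
      | Some E => fun t' => ssubst t' (t_csnd t_hole)
      end (self_tr t)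
  | t_case G D A B C s t u =>
      match D return
        self_ty G D (CPlus A B) -> self_ty G (Some A) C -> self_ty G (Some B) C ->
        self_ty G D C with
      | None => fun s' t' u' => t_llam (t_lapp s' (t_cpair t' u'))
      | Some E => fun s' t' u' => ssubst s' (t_cpair t' u')
      end (self_tr s) (self_tr t) (self_tr u)
  | t_llam _ _ _ t => t_llam (self_tr t)
  | t_lapp G D A B s t =>
      match D return self_ty G None (VLolli A B) -> self_ty G D A -> self_ty G D B with
      | None => fun s' t' => t_llam (t_lapp t' (t_lapp s' t_hole))
      | Some E => fun s' t' => ssubst t' (t_lapp s' t_hole)
      end (self_tr s) (self_tr t)
  end.

Definition tm_bullet {G A} (t : tm G None A) : tm (map vbullet G) None (vbullet A) :=
  self_tr t.

Definition tm_circ {G} {D B : ctype VC CC} (t : tm G (Some D) B) :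
    tm (map vbullet G) (Some (ccirc B)) (ccirc D) :=
  self_tr t.

End SelfTranslation.

Section Lambda.

Variable LC : Type.

Inductive lty : Type :=
| LConst (a : LC)
| LOne
| LProd (s t : lty)
| LArr (s t : lty).

Inductive ltm : seq lty -> lty -> Type :=
| l_var {Th s} : var Th s -> ltm Th s
| l_unit {Th} : ltm Th LOne
| l_pair {Th s t} : ltm Th s -> ltm Th t -> ltm Th (LProd s t)
| l_fst {Th s t} : ltm Th (LProd s t) -> ltm Th s
| l_snd {Th s t} : ltm Th (LProd s t) -> ltm Th t
| l_lam {Th s t} : ltm (s :: Th) t -> ltm Th (LArr s t)
| l_app {Th s t} : ltm Th (LArr s t) -> ltm Th s -> ltm Th t.

End Lambda.

Arguments LOne {LC}.

(* [c] sends a lambda-calculus type constant to its associated EEC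
   computation-type constant. *)

Section CallByName.

Variables (VC CC LC : Type) (c : LC -> CC).

Fixpoint ty_n (s : lty LC) : ctype VC CC :=
  match s with
  | LConst a => CConst (c a)
  | LOne => COne
  | LProd s t => CWith (ty_n s) (ty_n t)
  | LArr s t => CPow (ty_n s) (ty_n t)
  end.

Definition ctx_n (Th : seq (lty LC)) : vctx VC CC := map (fun s => VComp (ty_n s)) Th.

Fixpoint tm_n {Th s} (M : ltm Th s) : tm (ctx_n Th) None (ty_n s) :=
  match M in ltm Th s return tm (ctx_n Th) None (ty_n s) with
  | l_var _ _ x => t_var (var_map (fun s => VComp (ty_n s)) x)
  | l_unit _ => t_cunit
  | l_pair _ _ _ M N => t_cpair (tm_n M) (tm_n N)
  | l_fst _ _ _ M => t_cfst (tm_n M)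
  | l_snd _ _ _ M => t_csnd (tm_n M)
  | l_lam _ _ _ M => t_clam (tm_n M)
  | l_app _ _ _ M N => t_capp (tm_n M) (tm_n N)
  end.

Variable R : ctype VC CC.

Fixpoint ty_ln (s : lty LC) : ctype VC CC :=
  match s with
  | LConst a => CConst (c a)
  | LOne => CZero
  | LProd s t => CPlus (ty_ln s) (ty_ln t)
  | LArr s t => CTens (VLolli (ty_ln s) R) (ty_ln t)
  end.

Definition ctx_ln (Th : seq (lty LC)) : vctx VC CC := map (fun s => VLolli (ty_ln s) R) Th.

Fixpoint tm_ln {Th s} (M : ltm Th s) : tm (ctx_ln Th) None (VLolli (ty_ln s) R) :=
  match M in ltm Th s return tm (ctx_ln Th) None (VLolli (ty_ln s) R) with
  | l_var _ _ x => t_var (var_map (fun s => VLolli (ty_ln s) R) x)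
  | l_unit _ => t_llam (t_abort R t_hole)
  | l_pair _ _ _ M N =>
      t_llam (t_case t_hole (t_lapp (tm_ln M) t_hole) (t_lapp (tm_ln N) t_hole))
  | l_fst _ _ _ M => t_llam (t_lapp (tm_ln M) (t_inl t_hole))
  | l_snd _ _ _ M => t_llam (t_lapp (tm_ln M) (t_inr t_hole))
  | l_lam _ _ _ M => t_llam (t_lettens t_hole (t_lapp (tm_ln M) t_hole))
  | l_app _ _ _ M N => t_llam (t_lapp (tm_ln M) (t_tens (tm_ln N) t_hole))
  end.

End CallByName.

Arguments ty_n {VC CC LC} c s.
Arguments ctx_n {VC CC LC} c Th.
Arguments tm_n {VC CC LC} c {Th s} M.

(* Main.v *)
(** The linear-use CPS translation and the self-translation of the call-by-name
    translation follow the same clauses, so the two terms are syntactically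
    identical up to transport along the equality of their types; the EEC equation
    is then an instance of reflexivity.  The type and context equalities are built
    by recursion as congruences, so that transport along them commutes with each
    clause by elimination of equalities between arbitrary types, and uniqueness of
    identity proofs is never needed. *)
Require Import Defs.
From mathcomp Require Import all_boot.

Set Implicit Arguments.
Unset Strict Implicit.
Unset Printing Implicit Defensive.

(* [f_equal2] is opaque, which would block transport along [f_equal2 f erefl erefl]. *)
Definition congr2_eq (X Y Z : Type) (f : X -> Y -> Z) x x' y y'
    (ex : x = x') (ey : y = y') : f x y = f x' y' :=
  match ex, ey with erefl, erefl => erefl end.

Section Transport.

Variables VC CC : Type.
Implicit Types (G : vctx VC CC) (A B R : ctype VC CC).

Definition lolli_eq R A A' (e : A = A') : VLolli A R = VLolli A' R :=
  f_equal (fun X => VLolli X R) e.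

Lemma tm_cast_abort G G' (eG : G = G') R :
  tm_cast eG (lolli_eq R (erefl CZero)) (t_llam (t_abort R t_hole)) =
  t_llam (t_abort R t_hole).
Proof. by case: G' / eG. Qed.

Lemma tm_cast_case G G' (eG : G = G') R A A' (eA : A = A') B B' (eB : B = B')
    (t : tm G None (VLolli A R)) (u : tm G None (VLolli B R)) :
  tm_cast eG (lolli_eq R (congr2_eq (@CPlus VC CC) eA eB))
    (t_llam (t_case t_hole (t_lapp t t_hole) (t_lapp u t_hole))) =
  t_llam (t_case t_hole (t_lapp (tm_cast eG (lolli_eq R eA) t) t_hole)
                        (t_lapp (tm_cast eG (lolli_eq R eB) u) t_hole)).
Proof. by case: G' / eG; case: A' / eA; case: B' / eB. Qed.

(** The type of a projection forgets the other component, so [eB] enters only on the right, where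
    the whole pair is transported. *)
Lemma tm_cast_inl G G' (eG : G = G') R A A' (eA : A = A') B B' (eB : B = B')
    (t : tm G None (VLolli (CPlus A B) R)) :
  tm_cast eG (lolli_eq R eA) (t_llam (t_lapp t (t_inl t_hole))) =
  t_llam (t_lapp (tm_cast eG (lolli_eq R (congr2_eq (@CPlus VC CC) eA eB)) t)
                 (t_inl t_hole)).
Proof. by case: G' / eG; case: A' / eA; case: B' / eB. Qed.

Lemma tm_cast_inr G G' (eG : G = G') R A A' (eA : A = A') B B' (eB : B = B')
    (t : tm G None (VLolli (CPlus A B) R)) :
  tm_cast eG (lolli_eq R eB) (t_llam (t_lapp t (t_inr t_hole))) =
  t_llam (t_lapp (tm_cast eG (lolli_eq R (congr2_eq (@CPlus VC CC) eA eB)) t)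
                 (t_inr t_hole)).
Proof. by case: G' / eG; case: A' / eA; case: B' / eB. Qed.

(** Under the binder the context equality grows by one [congr2_eq cons], which is how
    [vbullet_ctx_n] computes on [s :: Th]. *)
Lemma tm_cast_lettens G G' (eG : G = G') R A A' (eA : A = A') B B' (eB : B = B')
    (t : tm (VLolli A R :: G) None (VLolli B R)) :
  tm_cast eG (lolli_eq R (congr2_eq (@CTens VC CC) (lolli_eq R eA) eB))
    (t_llam (t_lettens t_hole (t_lapp t t_hole))) =
  t_llam (t_lettens t_hole
    (t_lapp (tm_cast (congr2_eq cons (lolli_eq R eA) eG) (lolli_eq R eB) t) t_hole)).
Proof. by case: G' / eG; case: A' / eA; case: B' / eB. Qed.

Lemma tm_cast_tens G G' (eG : G = G') R A A' (eA : A = A') B B' (eB : B = B')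
    (t : tm G None (VLolli (CTens (VLolli A R) B) R))
    (u : tm G None (VLolli A R)) :
  tm_cast eG (lolli_eq R eB) (t_llam (t_lapp t (t_tens u t_hole))) =
  t_llam (t_lapp
    (tm_cast eG (lolli_eq R (congr2_eq (@CTens VC CC) (lolli_eq R eA) eB)) t)
    (t_tens (tm_cast eG (lolli_eq R eA) u) t_hole)).
Proof. by case: G' / eG; case: A' / eA; case: B' / eB. Qed.

Definition var_cast G G' (X X' : vtype VC CC) (eG : G = G') (eX : X = X')
    (x : var G X) : var G' X' :=
  match eG in _ = H, eX in _ = Y return var H Y with erefl, erefl => x end.

Lemma tm_cast_var G G' (eG : G = G') (X X' : vtype VC CC) (eX : X = X')
    (x : var G X) :
  tm_cast eG eX (t_var x) = t_var (var_cast eG eX x).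
Proof. by case: G' / eG; case: X' / eX. Qed.

Lemma var_cast_var0 G G' (eG : G = G') (X X' : vtype VC CC) (eX : X = X') :
  var_cast (congr2_eq cons eX eG) eX var0 = var0.
Proof. by case: G' / eG; case: X' / eX. Qed.

Lemma var_cast_varS G G' (eG : G = G') (X X' Y Y' : vtype VC CC)
    (eX : X = X') (eY : Y = Y') (x : var G X) :
  var_cast (congr2_eq cons eY eG) eX (varS x) = varS (var_cast eG eX x).
Proof. by case: G' / eG; case: X' / eX; case: Y' / eY. Qed.

End Transport.

Section LinearCPS.

Variables (VC : Type) (CC : eqType) (LC : Type) (c : LC -> CC) (R : ctype VC CC).
Hypothesis hR : forall a : LC, R <> CConst (c a).

(** The only clause where the two type translations could differ: if [R] were [CConst (c a)],
    [ccirc] would return [CI]. *)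
Lemma ccirc_const (a : LC) : ccirc R (CConst (c a)) = CConst (c a).
Proof.
rewrite /=; case: R hR => // b hb.
by case: eqP => // eab; case: (hb a); rewrite eab.
Qed.

(** Being transparent, it unfolds on each compound type to the congruence named in the matching
    transport lemma. The opaque leaf [ccirc_const] is harmless, as those lemmas hold for arbitrary
    component equalities. *)
Fixpoint ccirc_ty_n (s : lty LC) : ccirc R (ty_n c s) = ty_ln c R s :=
  match s return ccirc R (ty_n c s) = ty_ln c R s with
  | LConst a => ccirc_const a
  | LOne => erefl
  | LProd s t => congr2_eq (@CPlus VC CC) (ccirc_ty_n s) (ccirc_ty_n t)
  | LArr s t =>
      congr2_eq (@CTens VC CC) (lolli_eq R (ccirc_ty_n s)) (ccirc_ty_n t)
  end.

Fixpoint vbullet_ctx_n (Th : seq (lty LC)) :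
    map (vbullet R) (ctx_n c Th) = ctx_ln c R Th :=
  match Th return map (vbullet R) (ctx_n c Th) = ctx_ln c R Th with
  | [::] => erefl
  | s :: Th => congr2_eq cons (lolli_eq R (ccirc_ty_n s)) (vbullet_ctx_n Th)
  end.

Lemma tm_cast_bullet_n (Th : seq (lty LC)) (s : lty LC) (M : ltm Th s) :
  tm_cast (vbullet_ctx_n Th) (lolli_eq R (ccirc_ty_n s)) (tm_bullet R (tm_n c M)) =
  tm_ln c R M.
Proof.
elim: M => {Th s} [Th s x|Th|Th s t M IHM N IHN|Th s t M IHM|Th s t M IHM
                 |Th s t M IHM|Th s t M IHM N IHN].
- apply: etrans (tm_cast_var _ _ _) _; congr t_var.
  (* Two successive [var_map]s face a single one; induction on the position follows the recursion
     defining the context equality. *)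
  elim: x => {Th s} [Th s|Th s t x /= <-]; first exact: var_cast_var0.
  exact: var_cast_varS.
- exact: tm_cast_abort.
(* Read right to left, the induction hypotheses turn the CPS subterms into transported ones, leaving
   exactly the commutation lemma. *)
- by rewrite /= -IHM -IHN; exact: tm_cast_case.
- by rewrite /= -IHM; exact: tm_cast_inl.
- by rewrite /= -IHM; exact: tm_cast_inr.
- by rewrite /= -IHM; exact: tm_cast_lettens.
- by rewrite /= -IHM -IHN; exact: tm_cast_tens.
Qed.

End LinearCPS.

Theorem theorem6p2 (VC : Type) (CC : eqType) (LC : Type) (c : LC -> CC)
    (R : ctype VC CC) (hR : forall a : LC, R <> CConst (c a)) :
  (forall s : lty LC, ty_ln c R s = ccirc R (ty_n c s)) /\
  (forall s : lty LC, VLolli (ty_ln c R s) R = vbullet R (VComp (ty_n c s))) /\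
  (forall (Th : seq (lty LC)) (s : lty LC) (M : ltm Th s),
     exists (eTh : map (vbullet R) (ctx_n c Th) = ctx_ln c R Th)
            (es : vbullet R (VComp (ty_n c s)) = VLolli (ty_ln c R s) R),
       eqtm (tm_ln c R M) (tm_cast eTh es (tm_bullet R (tm_n c M)))).
Proof.
split; first by move=> s; rewrite ccirc_ty_n.
split; first by move=> s /=; rewrite ccirc_ty_n.
move=> Th s M; exists (vbullet_ctx_n hR Th), (lolli_eq R (ccirc_ty_n hR s)).
by rewrite tm_cast_bullet_n; exact: eqt_refl.
Qed.
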